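(* Let $\mathcal{C}\subseteq\mathbb{F}_2^{nL}$ be a linear binary code, and let $\Gamma_{C^\star}\subset\mathbb{R}^n$ be the Construction $C^\star$ generated by $\mathcal{C}$. Let $\mathcal{S}\subseteq\mathbb{F}_2^{nL}$ be the set of all vectors $(0,s_1,\dots,s_{L-1})$ obtained as $c=(c_1,\dots,c_L)$ and $\tilde c=(\tilde c_1,\dots,\tilde c_L)$ range over all pairs of codewords of $\mathcal{C}$ (including the case $c=\tilde c$), where $s_1=c_1\ast\tilde c_1$ and, for $i=2,\dots,L-1$, $$s_i=(c_i\ast\tilde c_i)\oplus r_i^{(1)}\oplus r_i^{(2)}\oplus\dots\oplus r_i^{(i-1)},$$ $$r_i^{(1)}=(c_i\oplus\tilde c_i)\ast(c_{i-1}\ast\tilde c_{i-1}),\qquad r_i^{(j)}=r_i^{(j-1)}\ast r_{i-1}^{(j-1)}\quad(2\le j\le i-1).$$ Then $\Gamma_{C^\star}$ is a lattice if and only if $\mathcal{S}\subseteq\mathcal{C}$.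
   Context: A codeword $c\in\mathcal{C}\subseteq\mathbb{F}_2^{nL}$ is partitioned into $L$ consecutive subvectors of length $n$, $c=(c_1,\dots,c_L)$ with $c_i\in\mathbb{F}_2^n$. Construction $C^\star$ generated by $\mathcal{C}$ is $\Gamma_{C^\star}=\{c_1+2c_2+\dots+2^{L-1}c_L+2^Lz:(c_1,\dots,c_L)\in\mathcal{C},\ z\in\mathbb{Z}^n\}\subset\mathbb{R}^n$, where vectors of $\mathbb{F}_2^n$ are regarded as vectors in $\{0,1\}^n\subset\mathbb{R}^n$ and $+$ is real addition. The symbol $\oplus$ denotes addition in $\mathbb{F}_2^n$ (coordinatewise mod 2), and $\ast$ is the Schur (coordinatewise) product $x\ast y=(x_1y_1,\dots,x_ny_n)$ on $\mathbb{F}_2^n$. In $(0,s_1,\dots,s_{L-1})$ the first entry is the zero vector of $\mathbb{F}_2^n$. A lattice in $\mathbb{R}^n$ is the set of all integer linear combinations of $n$ linearly independent vectors, equivalently a (full rank) discrete additive subgroup of $\mathbb{R}^n$. *)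

(* Defs.v *)
From mathcomp Require Import all_boot all_order all_algebra.
From mathcomp Require Import all_classical all_reals.
Set Implicit Arguments.
Unset Strict Implicit.
Unset Printing Implicit Defensive.
Import GRing.Theory Num.Theory.
Local Open Scope ring_scope.
Local Open Scope classical_set_scope.

(* F_2^{nL} is 'rV['F_2]_(L * n): [vec_mx] reads such a vector
   in row-major order as an L x n matrix whose rows are the L consecutive
   subvectors of length n (see [blockE]). *)

(* The levels are numbered from 1 as in c = (c_1, ..., c_L), whereas ordinals
   start at 0; out-of-range k gives 0. *)
Definition block (n L : nat) (c : 'rV['F_2]_(L * n)) (k : nat) : 'rV['F_2]_n :=
  if k is k'.+1 then oapp (fun i : 'I_L => row i (vec_mx c)) 0 (insub k') else 0.

Lemma mxvec_indexE (m n : nat) (i : 'I_m) (j : 'I_n) :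
  mxvec_index i j = (i * n + j)%N :> nat.
Proof.
have index_pairs (T1 T2 : eqType) (s : seq T1) (t : seq T2) x y :
    x \in s -> y \in t ->
    index (x, y) [seq (a, b) | a <- s, b <- t]
      = (index x s * size t + index y t)%N.
  elim: s => //= a s IHs; rewrite inE => xs yt.
  have pair_inj : injective (pair a : T2 -> T1 * T2) by move=> ? ? [].
  rewrite index_cat size_map; case: eqVneq xs => [-> _|ax /= xs].
    by rewrite map_f // index_map // eqxx.
  rewrite mulSn -addnA -IHs //.
  case: mapP => [[b _ [xa _]]|_] //.
  by rewrite xa eqxx in ax.
rewrite /mxvec_index /= -[RHS]/(i * n + j)%N.
have -> : nat_of_ord (enum_rank (i, j)) = index (i, j) (enum {: 'I_m * 'I_n}).
  have u := enum_uniq {: 'I_m * 'I_n}.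
  rewrite -[in RHS](nth_enum_rank (i, j) (i, j)) index_uniq //.
  by rewrite -cardE ltn_ord.
rewrite enumT unlock /= /prod_enum index_pairs ?mem_enum //.
by rewrite !index_enum_ord size_enum_ord.
Qed.

Lemma blockE (n L : nat) (c : 'rV['F_2]_(L * n)) (i : 'I_L) (j : 'I_n)
    (k : 'I_(L * n)) :
  k = (i * n + j)%N :> nat -> block c i.+1 0 j = c 0 k.
Proof.
move=> kE; rewrite /block valK /= !mxE; congr (c 0 _).
by apply: val_inj; rewrite [RHS]kE; apply: mxvec_indexE.
Qed.

Definition schur (n : nat) (x y : 'rV['F_2]_n) : 'rV['F_2]_n :=
  map2_mx (fun a b => a * b) x y.

(* r_i^(j) is only used for 1 <= j <= i - 1. *)
Fixpoint rterm (n : nat) (x y : nat -> 'rV['F_2]_n) (i j : nat) : 'rV['F_2]_n :=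
  match j with
  | 0 => 0
  | 1 => schur (x i + y i) (schur (x i.-1) (y i.-1))
  | j'.+1 => schur (rterm x y i j') (rterm x y i.-1 j')
  end.

(* s_i; for i = 1 the sum is empty. *)
Definition sterm (n : nat) (x y : nat -> 'rV['F_2]_n) (i : nat) : 'rV['F_2]_n :=
  schur (x i) (y i) + \sum_(1 <= j < i) rterm x y i j.

(* (0, s_1, ..., s_{L-1}): the row of ordinal index i is s_i. *)
Definition svec (n L : nat) (c c' : 'rV['F_2]_(L * n)) : 'rV['F_2]_(L * n) :=
  mxvec (\matrix_(i < L)
    (if i == 0%N :> nat then 0 else sterm (block c) (block c') i)).

Definition sset (n L : nat) (C : {vspace 'rV['F_2]_(L * n)}) :
    set 'rV['F_2]_(L * n) :=
  [set s | exists c c', [/\ c \in C, c' \in C & s = svec c c']].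

Definition bits (R : realType) (n : nat) (x : 'rV['F_2]_n) : 'rV[R]_n :=
  map_mx (fun b : 'F_2 => (nat_of_ord b)%:R) x.

Arguments bits R {n} x.

Definition construction_Cstar (R : realType) (n L : nat)
    (C : {vspace 'rV['F_2]_(L * n)}) : set 'rV[R]_n :=
  [set x | exists2 c, c \in C & exists z : 'rV[int]_n,
     x = \sum_(1 <= i < L.+1) 2 ^+ i.-1 *: bits R (block c i)
         + 2 ^+ L *: map_mx intr z].

Arguments construction_Cstar R {n L} C.

Definition is_lattice (R : realType) (n : nat) (X : set 'rV[R]_n) : Prop :=
  exists2 B : 'M[R]_n, row_free B
    & X = [set x | exists z : 'rV[int]_n, x = \sum_(i < n) (z 0 i)%:~R *: row i B].

(* Main.v *)
(* Read a word c as an integer vector modulo 2 ^ L.  Then a + b is the sum of the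
   binary (XOR) sum of a and b and of the carry word 2 (a AND b), which is
   bilinear over F_2; so Construction C* is closed under addition iff C is
   closed under carries.  Since uv(u + v) = 0 over F_2, all r_i^(j) with j >= 2
   vanish, and the word of S attached to a, b is p + N p, where p is the carry
   word of a, b and N, the carry with a + b, is nilpotent.  Hence closure under
   carries gives S in C, and conversely p = (1 + N)^-1 (p + N p) is recovered by
   induction on the number of low zero levels.  Finally, a subgroup of Z^n
   containing 2 ^ L Z^n has a basis by the Smith normal form. *)
Require Import Defs.
From mathcomp Require Import all_boot all_order all_algebra.
From mathcomp Require Import all_classical all_reals.
From mathcomp Require Import zify.
Import GRing.Theory Num.Theory.
Set Implicit Arguments.
Unset Strict Implicit.
Unset Printing Implicit Defensive.
Local Open Scope ring_scope.
Local Open Scope classical_set_scope.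

(** * Bases of subgroups of Z^n of finite index *)

(** Division with remainder by d shows that G is generated by the rows of d I and its finitely many
    members with entries in [0, d). The matrix [Y] witnesses that [B] is invertible over the
    rationals. *)
Lemma int_subgroup_basis (n d : nat) (G : set 'rV[int]_n) :
  (0 < d)%N ->
  (forall x y, G x -> G y -> G (x - y)) ->
  (forall w, G (d%:Z *: w)) ->
  exists B Y : 'M[int]_n,
    Y *m B = d%:Z%:M /\ forall x, G x <-> exists z, x = z *m B.
Proof.
case: d => // d _ GB Gd.
have G0 : G 0 by rewrite -(scaler0 _ d.+1%:Z); apply: Gd.
have GN x : G x -> G (- x) by rewrite -sub0r; apply: GB.
have GD x y : G x -> G y -> G (x + y) by rewrite -{2}(opprK y) => ? /GN; apply: GB.
have Gn x (m : nat) : G x -> G (m%:Z *: x).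
  move=> Gx; elim: m => [|m IHm]; first by rewrite scale0r.
  by rewrite intS scalerDl scale1r; apply: GD.
have Gz x (m : int) : G x -> G (m *: x).
  by move=> Gx; case: m => m; rewrite ?NegzE ?scaleNr; [|apply: GN]; apply: Gn.
pose V : finType := 'rV['I_d.+1]_n.
pose lft (v : V) : 'rV[int]_n := map_mx (fun k : 'I_d.+1 => (k : nat)%:Z) v.
(* Residue vectors outside G become zero rows, so every row lies in G. *)
pose M1 : 'M[int]_(#|V|, n) :=
  \matrix_i (if `[< G (lft (enum_val i)) >] then lft (enum_val i) else 0).
pose M : 'M[int]_(n + #|V|, n) := col_mx (d.+1%:Z%:M) M1.
have GM x : G x <-> exists u, x = u *m M.
  split=> [Gx | [u ->]].
    pose v : V := map_mx (fun k : int => inord `|(k %% d.+1%:Z)%Z|%N) x.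
    pose q : 'rV[int]_n := map_mx (fun k : int => (k %/ d.+1%:Z)%Z) x.
    have xE : x = d.+1%:Z *: q + lft v.
      apply/rowP => j; rewrite !mxE.
      have := modz_ge0 (x 0 j) (isT : d.+1%:Z != 0).
      have := ltz_pmod (x 0 j) (isT : (0 : int) < d.+1%:Z).
      rewrite {3}(divz_eq (x 0 j) d.+1%:Z) => ? ?.
      rewrite inordK; lia.
    have Gv : G (lft v).
      by rewrite -[lft v](addKr (d.+1%:Z *: q)) -xE addrC; apply: GB.
    exists (row_mx q (delta_mx 0 (enum_rank v))).
    rewrite mul_row_col mul_mx_scalar -rowE rowK enum_rankK.
    by rewrite asboolT.
  rewrite -[u]hsubmxK mul_row_col mul_mx_scalar; apply: (GD) => //.
  rewrite mulmx_sum_row; apply: big_ind => [||i _]; [exact: G0 | exact: GD | apply: Gz].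
  by rewrite rowK; case: asboolP.
have [P Pu [Q Qu [e _ ME]]] := int_Smith_normal_form M.
pose D : 'M[int]_n := \matrix_(i, j) (e`_i *+ (i == j :> nat)).
(* [M] has at least n rows, so its Smith form is a square block over zero rows; dropping these
   leaves n generators, the rows of [D *m Q]. *)
have MQ : M = P *m col_mx D 0 *m Q.
  rewrite ME; congr (_ *m _ *m _); apply/matrixP => i j.
  rewrite -[i]splitK; case: (fintype.split i) => k /=.
    by rewrite col_mxEu !mxE.
  rewrite col_mxEd !mxE /=.
  by rewrite (_ : (_ == _) = false) //; apply/eqP; have := ltn_ord j; lia.
have GB' x : G x <-> exists z, x = z *m (D *m Q).
  rewrite GM; split=> [[u ->] | [z ->]].
    exists (lsubmx (u *m P)).
    by rewrite MQ !mulmxA -{1}[u *m P]hsubmxK mul_row_col mulmx0 addr0.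
  exists (row_mx z 0 *m invmx P).
  by rewrite MQ !mulmxA mulmxKV // mul_row_col mulmx0 addr0.
have rowsP (i : 'I_n) : exists z : 'rV[int]_n, d.+1%:Z *: delta_mx 0 i = z *m (D *m Q).
  exact/GB'.
have [Y YE] := choice rowsP.
exists (D *m Q), (\matrix_i Y i); split=> //.
apply/row_matrixP => i; rewrite row_mul rowK -YE.
by rewrite -scalemx1 linearZ /= row1.
Qed.

Local Arguments block : simpl never.

(** * Blocks and carry words *)

Section Blocks.
Variables n L : nat.
Implicit Types (c a b p x y z : 'rV['F_2]_(L * n)) (k m : nat).

Lemma block_ord c (i : 'I_L) : block c i.+1 = row i (vec_mx c).
Proof. by rewrite /block valK. Qed.

Lemma block_mxvec (M : 'M['F_2]_(L, n)) (i : 'I_L) :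
  block (mxvec M) i.+1 = row i M.
Proof. by rewrite block_ord mxvecK. Qed.

Lemma block_default c k : (L < k)%N -> block c k = 0.
Proof. by case: k => // k Lk; rewrite /block insubF // ltnNge -ltnS Lk. Qed.

Lemma block_inj a b :
  (forall k, (0 < k <= L)%N -> block a k = block b k) -> a = b.
Proof.
move=> ab; apply: (can_inj vec_mxK); apply/row_matrixP => i.
by rewrite -!block_ord ab //= ltn_ord.
Qed.

Lemma blockD a b k : block (a + b) k = block a k + block b k.
Proof.
case: k => [|k]; first by rewrite addr0.
have [kL|Lk] := ltnP k L; last by rewrite !block_default ?addr0.
by rewrite -[k]/(nat_of_ord (Ordinal kL)) !block_ord !linearD.
Qed.

Lemma block_zero k : block (0 : 'rV['F_2]_(L * n)) k = 0.
Proof. by apply: (addIr (block (0 : 'rV['F_2]_(L * n)) k)); rewrite -blockD !add0r. Qed.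

(* With words read as binary integers mod 2 ^ L, this is 2 (a AND b); level 0
   is the zero block, so nothing enters at level 1. *)
Definition carry a b : 'rV['F_2]_(L * n) :=
  mxvec (\matrix_(i < L) schur (block a i) (block b i)).

Lemma block_carry a b k :
  (k < L)%N -> block (carry a b) k.+1 = schur (block a k) (block b k).
Proof.
move=> kL; rewrite -[k]/(nat_of_ord (Ordinal kL)) /carry block_mxvec.
by rewrite rowK.
Qed.

Lemma carryDr z a b : carry z (a + b) = carry z a + carry z b.
Proof.
apply: block_inj; case=> // k /= kL; rewrite [RHS]blockD !block_carry // blockD.
by apply/rowP => j; rewrite !mxE mulrDr.
Qed.

Lemma carry0 z : carry z 0 = 0.
Proof. by apply: (addIr (carry z 0)); rewrite -carryDr !add0r. Qed.

(* [c] is divisible by 2 ^ m. *)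
Definition low_zero m c := forall k, (k <= m)%N -> block c k = 0.

Lemma low_zeroL c : low_zero L c -> c = 0.
Proof.
by move=> c0; apply: block_inj => k /andP[_ kL]; rewrite c0 // block_zero.
Qed.

Lemma low_zeroD m a b : low_zero m a -> low_zero m b -> low_zero m (a + b).
Proof. by move=> a0 b0 k km; rewrite blockD a0 // b0 // addr0. Qed.

Lemma low_zeroW m m' c : (m' <= m)%N -> low_zero m c -> low_zero m' c.
Proof. by move=> mm c0 k km; apply/c0/(leq_trans km). Qed.

Lemma low_zero_carry m a b : low_zero m b -> low_zero m.+1 (carry a b).
Proof.
move=> b0 [|k] // km; have [kL|Lk] := ltnP k L; last by rewrite block_default.
by rewrite block_carry // b0 //; apply/rowP => j; rewrite !mxE mulr0.
Qed.

(** * The words of S and closure under carries *)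

Lemma F2_mul_mul_add (u v : 'F_2) : u * v * (u + v) = 0.
Proof.
by case: u v => [[|[|]]] // ? [[|[|]]] // ?; apply: val_inj.
Qed.

(** In r_i^(2), the factor r_i^(1) brings u_{i-1} v_{i-1} and the factor r_{i-1}^(1) brings u_{i-1}
    + v_{i-1}; the later terms are products of zeros. *)
Lemma rterm_eq0 (u v : nat -> 'rV['F_2]_n) i j : rterm u v i j.+2 = 0.
Proof.
elim: j i => [|j IHj] i; last first.
  rewrite -[LHS]/(schur (rterm u v i j.+2) (rterm u v i.-1 j.+2)) !IHj.
  by apply/rowP => l; rewrite !mxE mulr0.
apply/rowP => l; rewrite !mxE.
by rewrite -mulrA [X in _ * X]mulrA F2_mul_mul_add mul0r mulr0.
Qed.

Lemma svecE a b : svec a b = carry a b + carry (a + b) (carry a b).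
Proof.
apply: block_inj; case=> // k /= kL.
rewrite blockD !block_carry // /svec -[k]/(nat_of_ord (Ordinal kL)) block_mxvec rowK /=.
case: k kL => [|k] kL /=; first by apply/rowP => j; rewrite !mxE !mulr0 addr0.
rewrite blockD block_carry ?(ltnW kL) // /sterm; congr (_ + _).
(* For s_1 the sum is empty, and on the carry side block 0 is zero by default. *)
case: k kL => [|k] kL.
  by rewrite big_geq //; apply/rowP => j; rewrite !mxE !mulr0.
rewrite big_ltn // big_add1 big1_seq ?addr0 // => -[|j] jL.
  by rewrite mem_index_iota in jL.
by rewrite rterm_eq0.
Qed.

(** Two nested inductions: the outer one on the number of levels where [y] may be nonzero, the inner
    one inverting 1 + N on the carry word. *)
Lemma carry_closed (C : {vspace 'rV['F_2]_(L * n)}) :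
  (forall a b, a \in C -> b \in C -> svec a b \in C) ->
  forall a b, a \in C -> b \in C -> carry a b \in C.
Proof.
move=> CS a b aC bC.
suff low_closed m : forall x y, x \in C -> y \in C -> low_zero (L - m) y ->
    carry x y \in C.
  by apply: (low_closed L) => //; rewrite subnn => k; rewrite leqn0 => /eqP ->.
elim: m => [|m IHm] x y xC yC y0.
  by rewrite subn0 in y0; rewrite (low_zeroL y0) carry0 mem0v.
have p0 : low_zero (L - m) (carry x y).
  by apply: low_zeroW (low_zero_carry _ y0); lia.
have := CS _ _ xC yC; rewrite svecE.
have : x + y \in C by apply: memvD.
move: (x + y) (carry x y) p0 => z p p0 zC.
(* If q + N q is in C, where N = carry z, then so is N q + N (N q) =
   N (q + N q), and N q has more low zeros than q. *)
suff neumann j : forall q, low_zero (L - j) q -> low_zero (L - m) q ->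
    q + carry z q \in C -> q \in C.
  by apply: (neumann m).
elim: j => [|j IHj] q q0 qm0 sC.
  by rewrite subn0 in q0; rewrite (low_zeroL q0) mem0v.
have Nq m' : low_zero m' q -> low_zero m'.+1 (carry z q) by apply: low_zero_carry.
suff NqC : carry z q \in C by rewrite -(addrK (carry z q) q) memvB.
apply: IHj.
- by apply: low_zeroW (Nq _ q0); lia.
- by apply: low_zeroW (Nq _ qm0); lia.
(* The word q + N q is in C and has the L - m low zeros that the outer hypothesis demands. *)
rewrite -carryDr; apply: IHm => //; apply: low_zeroD => //.
by apply: low_zeroW (Nq _ qm0); lia.
Qed.

(** * Words as integer vectors modulo 2 ^ L *)

Definition word_int c : 'rV[int]_n :=
  \sum_(0 <= i < L) 2 ^+ i *: map_mx (fun u : 'F_2 => (nat_of_ord u)%:Z) (block c i.+1).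

Lemma word_intE c j :
  word_int c 0 j = \sum_(0 <= i < L) 2 ^+ i * (nat_of_ord (block c i.+1 0 j))%:Z.
Proof. by rewrite /word_int summxE; apply: eq_bigr => i _; rewrite !mxE. Qed.

Lemma F2_natD (u v : 'F_2) :
  (nat_of_ord u)%:Z + (nat_of_ord v)%:Z
  = (nat_of_ord (u + v))%:Z + 2 * (nat_of_ord (u * v))%:Z.
Proof. by case: u v => [[|[|]]] // ? [[|[|]]]. Qed.

Lemma word_intD a b : exists w : 'rV[int]_n,
    word_int a + word_int b
    = word_int (a + b) + word_int (carry a b) + 2 ^+ L *: w.
Proof.
pose f i : 'rV[int]_n :=
  map_mx (fun u : 'F_2 => (nat_of_ord u)%:Z) (schur (block a i) (block b i)).
(* [f L] is the carry out of the top level, which [carry a b] drops. *)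
exists (f L); rewrite -addrA.
have f0 : f 0%N = 0 by apply/rowP => j; rewrite !mxE mulr0.
have -> : word_int (carry a b) + 2 ^+ L *: f L
    = \sum_(0 <= i < L) 2 ^+ i.+1 *: f i.+1.
  have -> : word_int (carry a b) = \sum_(0 <= i < L) 2 ^+ i *: f i.
    by apply: eq_big_nat => i /andP[_ iL]; rewrite block_carry.
  by rewrite -big_nat_recr //= big_nat_recl //= f0 scaler0 add0r.
rewrite /word_int -!big_split /=; apply: eq_bigr => i _.
rewrite exprSr -scalerA -!scalerDr; congr (_ *: _).
by apply/rowP => j; rewrite !mxE blockD !mxE F2_natD.
Qed.

(** Parity determines the lowest digit; cancelling it and halving leaves l - 1 digits and the same
    [w]. *)
Lemma binary_inj (l : nat) (u v : nat -> 'F_2) (w : int) :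
  \sum_(0 <= i < l) 2 ^+ i * (nat_of_ord (u i))%:Z
  = \sum_(0 <= i < l) 2 ^+ i * (nat_of_ord (v i))%:Z + 2 ^+ l * w ->
  forall i, (i < l)%N -> u i = v i.
Proof.
elim: l u v => // l IHl u v; rewrite !big_nat_recl // !expr0 !mul1r.
have shift (t : nat -> 'F_2) : \sum_(0 <= i < l) 2 ^+ i.+1 * (nat_of_ord (t i.+1))%:Z
    = 2 * \sum_(0 <= i < l) 2 ^+ i * (nat_of_ord (t i.+1))%:Z.
  by rewrite mulr_sumr; apply: eq_bigr => i _; rewrite exprS mulrA.
rewrite !shift exprS -mulrA => uv.
have u2 : (u 0%N < 2)%N := ltn_ord (u 0%N).
have v2 : (v 0%N < 2)%N := ltn_ord (v 0%N).
have IH := IHl (fun i => u i.+1) (fun i => v i.+1).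
case=> [_|i il]; last by apply: IH => //; lia.
apply: val_inj; rewrite /=; lia.
Qed.

Lemma word_int_inj a b (w : 'rV[int]_n) :
  word_int a = word_int b + 2 ^+ L *: w -> a = b.
Proof.
move=> ab; apply: block_inj; case=> // k /= kL; apply/rowP => j.
apply: (@binary_inj L (fun i => block a i.+1 0 j)
                      (fun i => block b i.+1 0 j) (w 0 j)) => //.
by rewrite -!word_intE ab !mxE.
Qed.

Definition Cstar_int (C : {vspace 'rV['F_2]_(L * n)}) : set 'rV[int]_n :=
  [set x | exists2 c, c \in C & exists w, x = word_int c + 2 ^+ L *: w].

Lemma Cstar_intB (C : {vspace 'rV['F_2]_(L * n)}) :
  (forall a b, a \in C -> b \in C -> carry a b \in C) ->
  forall x y : 'rV[int]_n, Cstar_int C x -> Cstar_int C y -> Cstar_int C (x - y).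
Proof.
move=> CC.
(* Ripple-carry addition: each round replaces b by a carry word with one more low zero, so at most L
   rounds are needed. *)
have word_add m : forall a b, a \in C -> b \in C -> low_zero (L - m) b ->
    Cstar_int C (word_int a + word_int b).
  elim: m => [|m IHm] a b aC bC b0.
    rewrite subn0 in b0; exists a => //; exists 0.
    rewrite (low_zeroL b0) scaler0; congr (_ + _); apply/rowP => j.
    by rewrite word_intE mxE big1 // => i _; rewrite block_zero mxE mulr0.
  have [w ->] := word_intD a b.
  have [|||c cC [w' ->]] := IHm (a + b) (carry a b).
  - exact: memvD.
  - exact: CC.
  - by apply: low_zeroW (low_zero_carry _ b0); lia.
  by exists c => //; exists (w' + w); rewrite scalerDr addrA.
have Gw (x w : 'rV[int]_n) : Cstar_int C x -> Cstar_int C (x + 2 ^+ L *: w).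
  by case=> c cC [w' ->]; exists c => //; exists (w' + w); rewrite scalerDr addrA.
have GD (x y : 'rV[int]_n) : Cstar_int C x -> Cstar_int C y -> Cstar_int C (x + y).
  case=> a aC [u ->] [b bC [v ->]].
  rewrite addrACA -scalerDr; apply: (Gw); apply: (word_add L) => //.
  by rewrite subnn => k; rewrite leqn0 => /eqP ->.
(* Modulo 2 ^ L, -y is the positive multiple (2 ^ L - 1) y. *)
move=> x y Gx Gy.
have Gmul (m : nat) : Cstar_int C (x + m%:Z *: y).
  elim: m => [|m IHm]; first by rewrite scale0r addr0.
  by rewrite intS scalerDl scale1r (addrC y) addrA; apply: (GD).
have := Gw _ (- y) (Gmul (2 ^ L).-1); congr (Cstar_int C _).
have -> : ((2 ^ L).-1)%:Z = 2 ^+ L - 1.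
  by rewrite predn_int ?expn_gt0 // -[in LHS]natz natrX.
by rewrite scalerBl scale1r scalerN addrAC addrA subrK.
Qed.
End Blocks.

(** * Passage to real lattices and the equivalence *)

Lemma construction_CstarE (R : realType) (n L : nat) (C : {vspace 'rV['F_2]_(L * n)}) :
  construction_Cstar R C = [set map_mx intr x | x in Cstar_int C].
Proof.
have wordE (c : 'rV['F_2]_(L * n)) (w : 'rV[int]_n) :
    \sum_(1 <= i < L.+1) 2 ^+ i.-1 *: bits R (block c i) + 2 ^+ L *: map_mx intr w
    = map_mx intr (word_int c + 2 ^+ L *: w).
  rewrite big_add1 /=; apply/rowP => j; rewrite !mxE summxE word_intE.
  rewrite rmorphD rmorphM rmorphXn /= rmorph_sum /=; congr (_ + _).
  by apply: eq_bigr => i _; rewrite !mxE rmorphM rmorphXn.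
apply/seteqP; split=> x.
  case=> c cC [w ->]; exists (word_int c + 2 ^+ L *: w) => //.
  by exists c => //; exists w.
by case=> _ [c cC [w ->]] <-; exists c => //; exists w; rewrite wordE.
Qed.

Lemma sum_scale_row_intr (R : realType) (n : nat) (B : 'M[int]_n) (z : 'rV[int]_n) :
  \sum_(i < n) (z 0 i)%:~R *: row i (map_mx intr B) = map_mx intr (z *m B) :> 'rV[R]_n.
Proof.
rewrite map_mxM mulmx_sum_row; apply: eq_bigr => i _.
by rewrite mxE.
Qed.

Lemma is_latticeB (R : realType) (n : nat) (X : set 'rV[R]_n) :
  is_lattice X -> forall x y, X x -> X y -> X (x - y).
Proof.
case=> B _ -> _ _ [u ->] [v ->]; exists (u - v).
rewrite -sumrB; apply: eq_bigr => i _.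
by rewrite !mxE rmorphB scalerBl.
Qed.

Theorem theorem5 (R : realType) (n L : nat) (C : {vspace 'rV['F_2]_(L * n)}) :
  is_lattice (construction_Cstar R C) <-> sset C `<=` [set` C].
Proof.
split=> [Clat s [a [b [aC bC ->]]] | CS].
  have inj_intr : injective (@map_mx _ R intr 1 n).
    by move=> u v /rowP uv; apply/rowP => j; have := uv j; rewrite !mxE => /intr_inj.
  have GB (x y : 'rV[int]_n) : Cstar_int C x -> Cstar_int C y -> Cstar_int C (x - y).
    move=> Gx Gy; have := is_latticeB Clat; rewrite construction_CstarE.
    move=> /(_ (map_mx intr x) (map_mx intr y)).
    by case=> [||z Gz]; [exists x | exists y | rewrite -map_mxB => /inj_intr <-].
  have Gc c : c \in C -> Cstar_int C (word_int c).
    by move=> cC; exists c => //; exists 0; rewrite scaler0 addr0.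
  have CC c c' : c \in C -> c' \in C -> carry c c' \in C.
    move=> cC c'C; have [w wE] := word_intD c c'.
    have G0 : Cstar_int C 0 by rewrite -(subrr (word_int c)); apply: GB; apply: Gc.
    (* Modulo 2 ^ L this element is the value of the carry word; uniqueness of binary digits then
       puts that word in C. *)
    have : Cstar_int C (word_int c - (word_int (c + c') - word_int c')).
      by apply: (GB); [|apply: (GB)]; apply: Gc => //; apply: memvD.
    have -> : word_int c - (word_int (c + c') - word_int c')
        = word_int (carry c c') + 2 ^+ L *: w.
      by rewrite opprB addrA wE [LHS]addrC !addrA addNr add0r.
    case=> e eC [w' eE]; suff -> : carry c c' = e by [].
    apply: (@word_int_inj _ _ _ _ (w' - w)).
    by rewrite scalerBr addrA -eE addrK.
  rewrite /= svecE; apply: memvD; first exact: CC.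
  by apply: (CC); [apply: memvD | apply: CC].
have CC : forall a b, a \in C -> b \in C -> carry a b \in C.
  by apply: carry_closed => a b aC bC; apply: CS; exists a, b.
have L2 : (0 < 2 ^ L)%N by rewrite expn_gt0.
have L2z : (2 ^ L)%N%:Z = 2 ^+ L by rewrite -[LHS]natz natrX.
have G2 w : Cstar_int C ((2 ^ L)%N%:Z *: w).
  exists 0; first exact: mem0v.
  exists w; rewrite L2z -[LHS]add0r; congr (_ + _); apply/rowP => j.
  by rewrite word_intE mxE big1 // => i _; rewrite block_zero mxE mulr0.
have [B [Y [YB GB]]] := int_subgroup_basis L2 (Cstar_intB CC) G2.
exists (map_mx intr B).
  rewrite row_free_unit.
  (* From Y B = 2 ^ L I, the matrix Y / 2 ^ L is a real inverse of B. *)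
  suff : (2 ^ L)%:R^-1 *: map_mx intr Y *m map_mx intr B = 1%:M :> 'M[R]_n.
    by case/mulmx1_unit.
  rewrite -scalemxAl -map_mxM YB map_scalar_mx /= scale_scalar_mx mulVf //.
  by rewrite pnatr_eq0 -lt0n.
rewrite construction_CstarE; apply/seteqP; split=> x.
  case=> y /GB [z ->] <-; by exists z; rewrite sum_scale_row_intr.
by case=> z ->; exists (z *m B); [apply/GB; exists z | rewrite sum_scale_row_intr].
Qed.
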